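(* Let $G$ be a Lie group whose Lie algebra $\mathfrak{g}=\mathfrak{v}\dot{+}\mathfrak{z}$ is a real step-two nilpotent Lie algebra arising from a semi-simple module $(\mathfrak{v},j)$, as in the context. Then the equilibrium points of the Lie-Poisson equation $\frac{dY_{\mathfrak{v}}}{dt}=j(Y_{\mathfrak{z}})Y_{\mathfrak{v}}$, $\frac{dY_{\mathfrak{z}}}{dt}=0$ (restricted to the coadjoint orbits) are elliptic and hence Lyapunov stable.
   Context: Step-two nilpotent Lie algebra arising from a semi-simple module. Let $(\mathfrak{z},[\cdot,\cdot]_{\mathfrak{z}})$ be a real semi-simple Lie algebra and $j:\mathfrak{z}\to\mathrm{End}(\mathfrak{v})$ a representation on a finite-dimensional real vector space $\mathfrak{v}$. Suppose the vector space $\mathfrak{g}=\mathfrak{v}\dot{+}\mathfrak{z}$ carries a (positive-definite) inner product $\langle\cdot,\cdot\rangle$ such that: (1) $\mathfrak{v}\perp\mathfrak{z}$; (2) $\langle j(Z)V,V'\rangle+\langle V,j(Z)V'\rangle=0$ for all $Z\in\mathfrak{z}$, $V,V'\in\mathfrak{v}$; (3) $\langle[Z_1,Z_2]_{\mathfrak{z}},Z_3\rangle+\langle Z_2,[Z_1,Z_3]_{\mathfrak{z}}\rangle=0$ for all $Z_1,Z_2,Z_3\in\mathfrak{z}$. Then $\mathfrak{g}$ is given the step-two nilpotent Lie bracket $[\cdot,\cdot]$ with values in $\mathfrak{z}$ determined by $$\langle[V+Z,V'+Z'],Z''\rangle=\langle j(Z'')V,V'\rangle,\qquad V,V'\in\mathfrak{v},\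 Z,Z',Z''\in\mathfrak{z}.$$ The $j$-mapping of $(\mathfrak{g},[\cdot,\cdot])$ is the representation $j$. Write $Y=Y_{\mathfrak{v}}+Y_{\mathfrak{z}}$ with $Y_{\mathfrak{v}}\in\mathfrak{v}$, $Y_{\mathfrak{z}}\in\mathfrak{z}$. Identify $\mathfrak{g}\cong\mathfrak{g}^*$ via $Y\mapsto\langle Y,\cdot\rangle$; the coadjoint orbit through $Y$ is $\{(\mathrm{Ad}_q)^{\mathrm{T}}Y:q\in G\}$, where $A^{\mathrm{T}}$ is the adjoint of $A$ for $\langle\cdot,\cdot\rangle$; its tangent space at $Y$ is $\mathrm{Im}\,j(Y_{\mathfrak{z}})$. The Lie-Poisson equation (the reduction of the geodesic flow of the left-invariant metric defined by $\langle\cdot,\cdot\rangle$) restricts to each coadjoint orbit; its equilibria are the points with $Y_{\mathfrak{v}}\in\ker j(Y_{\mathfrak{z}})$. An equilibrium is elliptic if the linearization at it (of the equation restricted to the orbit through it) is diagonalizable over $\mathbb{C}$ and has only purely imaginary eigenvalues; stability is meant for the equation restricted to that orbit. *)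

(* Defs.v *)
From HB Require Import structures.
From mathcomp Require Import all_boot all_order all_algebra.
From mathcomp Require Import sesquilinear.
From mathcomp Require Import all_classical all_reals all_analysis.
From mathcomp.real_closed Require Import complex.

Set Implicit Arguments.
Unset Strict Implicit.
Unset Printing Implicit Defensive.

Import Order.TTheory GRing.Theory Num.Theory.
Import numFieldNormedType.Exports.

Local Open Scope classical_set_scope.
Local Open Scope ring_scope.

(* A finite-dimensional real vector space with its usual topology: the norm
   only serves to give access to limits and derivatives (all norms on such a
   space are equivalent) and is unrelated to the inner product used below. *)
#[short(type="normedVectType")]
HB.structure Definition NormedVector (R : numFieldType) :=
  {V of NormedModule R V & Vector R V}.

HB.instance Definition _ (R : numFieldType) (V W : normedVectType R) :=
  Vector.on (V * W)%type.

HB.mixin Record isTopologicalGroup G & Topological G & Group G := {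
  mulg_continuous : continuous (fun p : G * G => (p.1 * p.2)%g);
  invg_continuous : continuous (fun x : G => (x^-1)%g) }.

#[short(type="topologicalGroupType")]
HB.structure Definition TopologicalGroup :=
  {G of Topological G & Group G & isTopologicalGroup G}.

Section LieAlgebra.
Context {K : fieldType} {L : vectType K} (br : {bilinear L -> L -> L}).
Implicit Types U W : {vspace L}.

Definition is_lie_bracket : Prop :=
  (forall x, br x x = 0) /\
  (forall x y z, br x (br y z) + br y (br z x) + br z (br x y) = 0).

Definition lie_prod U W : {vspace L} :=
  <<[seq br x y | x <- vbasis U, y <- vbasis W]>>%VS.

Definition lie_ideal U : bool := (lie_prod fullv U <= U)%VS.

Definition lie_solvable U : Prop :=
  exists k, iter k (fun W => lie_prod W W) U = 0%VS.

(* the radical, i.e. the largest solvable ideal, is zero *)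
Definition lie_semisimple : Prop :=
  forall U, lie_ideal U -> lie_solvable U -> U = 0%VS.

End LieAlgebra.

Section SemisimpleModule.
Context {R : realType} {v z : normedVectType R}.

(* brz is the semi-simple bracket of z, lb the step-two nilpotent one of
   g = v * z; an element Y of g has components Y.1 in v and Y.2 in z. *)
Record arises_from_semisimple_module (brz : {bilinear z -> z -> z})
    (j : {linear z -> 'End(v)}) (ip : {dot (v * z)%type for idfun})
    (lb : {bilinear (v * z)%type -> (v * z)%type -> (v * z)%type}) : Prop := {
  module_lie : is_lie_bracket brz;
  module_semisimple : lie_semisimple brz;
  module_representation :
    forall Z1 Z2, j (brz Z1 Z2) = (j Z1 \o j Z2 - j Z2 \o j Z1)%VF;
  module_orthogonal : forall V Z, ip (V, 0) (0, Z) = 0;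
  module_skew : forall Z V V',
    ip (j Z V, 0) (V', 0) + ip (V, 0) (j Z V', 0) = 0;
  module_ad_skew : forall Z1 Z2 Z3,
    ip (0, brz Z1 Z2) (0, Z3) + ip (0, Z2) (0, brz Z1 Z3) = 0;
  bracket_in_center : forall X X', (lb X X').1 = 0;
  bracketE : forall X X' Z, ip (lb X X') (0, Z) = ip (j Z X.1, 0) (X'.1, 0) }.

End SemisimpleModule.

Section LieGroup.
Context {R : realType} {g : normedVectType R}.

(* The topological group G is a Lie group whose Lie algebra is (g, lb), with
   exponential map exp and adjoint representation Ad.  A topological group with
   a local homeomorphism exp at 0 is locally Euclidean, so it carries a unique
   Lie group structure; exp_ray makes t |-> exp (t *: X) one-parameter
   subgroups, and exp_trotter and ad_bracket say that the vector space
   structure and the bracket of g are those of the Lie algebra of G.  Neither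
   connectedness nor simple connectedness of G is assumed. *)
Record lie_group_with_lie_algebra (lb : {bilinear g -> g -> g})
    (G : topologicalGroupType) (exp : g -> G) (Ad : G -> 'End(g)) : Prop := {
  exp_continuous : continuous exp;
  exp_local_homeo : exists U : set g, [/\ open_nbhs 0 U,
    (forall X Y, U X -> U Y -> exp X = exp Y -> X = Y) &
    (forall A, open A -> A `<=` U -> open (exp @` A))];
  exp_ray : forall (s t : R) X,
    exp ((s + t) *: X) = (exp (s *: X) * exp (t *: X))%g;
  exp_trotter : forall X Y : g,
    (fun n : nat => ((exp (n.+1%:R^-1 *: X) *
                      exp (n.+1%:R^-1 *: Y)) ^+ n.+1)%g) @ \oo --> exp (X + Y);
  exp_Ad : forall (q : G) X, (q * exp X * q^-1)%g = exp (Ad q X);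
  ad_bracket : forall X Y : g,
    is_derive (0 : R) 1 (fun t : R => Ad (exp (t *: X)) Y) (lb X Y) }.

End LieGroup.

Section Coadjoint.
Context {R : realType} {g : normedVectType R} (ip : {dot g for idfun}).
Context {G : topologicalGroupType} (exp : g -> G) (Ad : G -> 'End(g)).
Implicit Types (q : G) (X Y : g).

(* Y' = (Ad_q)^T Y, the transpose being taken with respect to ip *)
Definition coadjoint q Y Y' : Prop := forall W, ip Y' W = ip Y (Ad q W).

Definition coadjoint_orbit Y : set g := [set Y' | exists q, coadjoint q Y Y'].

(* Neighbourhoods of Y in its orbit, for the topology of the orbit as a
   homogeneous space of G.  For disconnected G this can be finer than the
   topology induced by g. *)
Definition coadjoint_orbit_nbhs Y (U : set g) : Prop :=
  \forall q \near (1%g : G), forall Y', coadjoint q Y Y' -> U Y'.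

Definition coadjoint_orbit_velocity Y W : Prop :=
  exists (X : g) (c : R -> g),
    (forall t, coadjoint (exp (t *: X)) Y (c t)) /\ is_derive (0 : R) 1 c W.

Definition coadjoint_orbit_tangent Y (T : {vspace g}) : Prop :=
  forall W, W \in T <-> coadjoint_orbit_velocity Y W.

Definition solution_on_orbit (F : g -> g) Y (c : R -> g) : Prop :=
  [/\ forall t, 0 <= t -> coadjoint_orbit Y (c t),
      {within `[0, +oo[, continuous c} &
      forall t : R, 0 < t -> is_derive t 1 c (F (c t))].

Definition lyapunov_stable_on_orbit (F : g -> g) Y : Prop :=
  forall U, coadjoint_orbit_nbhs Y U ->
  exists2 U', coadjoint_orbit_nbhs Y U' &
    forall Y0, coadjoint_orbit Y Y0 -> U' Y0 ->
      (exists2 c, solution_on_orbit F Y c & c 0 = Y0) /\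
      (forall c, solution_on_orbit F Y c -> c 0 = Y0 ->
        forall t, 0 <= t -> U (c t)).

Definition complexified_mx (V : vectType R) (f : 'End(V)) :
    'M[R[i]]_(\dim {:V}) :=
  map_mx (real_complex R) (passmx.mxof (vbasis {:V}) (vbasis {:V}) f).

(* At an equilibrium Y of F, the linearization of the restriction of F to the
   orbit is the restriction of 'd F Y to the tangent space T of the orbit. *)
Definition elliptic_on_orbit (F : g -> g) Y : Prop :=
  differentiable F Y /\
  exists2 T : {vspace g}, coadjoint_orbit_tangent Y T &
  exists2 f : 'End(subvs_of T), (forall W, vsval (f W) = 'd F Y (vsval W)) &
    diagonalizable (complexified_mx f) /\
    (forall a : R[i], eigenvalue (complexified_mx f) a -> complex.Re a = 0).

End Coadjoint.

Section LiePoisson.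
Context {R : realType} {v z : normedVectType R} (j : z -> 'End(v)).

Definition lie_poisson (Y : v * z) : v * z := (j Y.2 Y.1, 0).

End LiePoisson.

(* Main.v *)
Require Import Defs.
From HB Require Import structures.
From mathcomp Require Import all_boot all_order all_algebra.
From mathcomp Require Import sesquilinear.
From mathcomp Require Import all_classical all_reals all_analysis.
From mathcomp Require Import spectral.
From mathcomp Require Import ring lra.
From mathcomp.real_closed Require Import complex.

Set Implicit Arguments.
Unset Strict Implicit.
Unset Printing Implicit Defensive.

Import Order.TTheory GRing.Theory Num.Theory.
Import numFieldNormedType.Exports passmx.

Local Open Scope classical_set_scope.
Local Open Scope ring_scope.

(** The equilibria are stable for the reason that a harmonic oscillator is: the
    linearized equation is driven by an operator that is skew for the inner
    product, hence it preserves the norm.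

    In a two-step group the exponential of [ad X] stops after its linear term,
    so [Ad (exp X) W = W + [X, W]] ([Ad_exp_step2]).  Transposing with the
    formula that defines the bracket, the coadjoint action of [exp X] on [Y]
    just adds [(j Y.2 X.1, 0)] ([coadjoint_expP]): near [Y] the orbit is the
    affine space [Y + T], where [T] is the image of [j Y.2] inside [v], and [T]
    is its tangent space.

    On [T] the derivative of the Lie-Poisson vector field is [j Y.2], which
    is skew.  In an orthonormal basis of [T] it becomes a real skew matrix, thus
    a normal complex one; the spectral theorem diagonalizes it by a unitary
    matrix, and taking adjoints shows that the eigenvalues are purely imaginary
    ([skew_diagonalization]).  This is ellipticity.

    For stability, write a point of the orbit near [Y] as [Y + W] with [W] in
    [T].  Since [Y] is an equilibrium, the field at [Y + W] is exactly the
    linearized field at [W].  The diagonalization solves this linear equation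
    with sines and cosines, inside [T], hence inside the orbit
    ([solution_exists]).  Conversely, along any solution the central component is
    constant, [W] remains in [T], and [ip W W] is constant because the operator
    is skew ([solution_invariants]).  So the sets of [Y + W] with [W] in [T] and
    [ip W W < e] are invariant.  They form a basis of neighbourhoods of [Y] in
    its orbit: one inclusion uses that [exp] is a local homeomorphism
    ([near_exp]), the other a linear section of [j Y.2] and the equivalence of
    norms in finite dimension ([norm_le_dot]).

    The bare topology on [v] and [z] enters through [linear_continuous_fd]:
    every linear map out of a finite-dimensional normed space is continuous. *)

(** * Finite-dimensional normed spaces *)

Section FiniteDimension.
Context {R : realType}.

Local Notation rV_to_vec V := (@vecof R V (vbasis {:V})).

Lemma vecof_continuous (V : normedVectType R) : continuous (rV_to_vec V).
Proof.
apply: continuous_big => [|i _ x]; first exact: add_continuous.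
by apply: (@cvgZr_tmp _ _ _ (nbhs x)); exact: coord_continuous.
Qed.

(** The norm of [V], read in coordinates, is continuous and positive on the
    compact unit sphere of the sup norm, so it has a positive minimum there. *)
Lemma norm_vecof_ge (V : normedVectType R) :
  exists2 m : R, 0 < m & forall x, m * `|x| <= `|rV_to_vec V x|.
Proof.
(* The sphere is empty when V is trivial. *)
pose S := [set x : 'rV[R]_(\dim {:V}) | `|x| = 1].
have S_scale (x : 'rV[R]_(\dim {:V})) : x != 0 -> S (`|x|^-1 *: x).
  move=> x0; rewrite /S /= normrZ normfV normr_id mulVf// normr_eq0//.
have [S0|/set0P S0] := eqVneq S set0.
  exists 1 => // x; have [->|x0] := eqVneq x 0.
    by rewrite normr0 mulr0.
  by have := S_scale _ x0; rewrite S0.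
have bS : bounded_set S.
  exists 1; split; first exact: num_real.
  by move=> y y1 x /= ->; exact: ltW.
have cS : closed S.
  rewrite (_ : S = (fun x => `|x|) @^-1` [set 1])//.
  apply: preimage_closed; last exact: closed_eq.
  by move=> x _; exact: norm_continuous.
have cf : {within S, continuous (fun x => `|rV_to_vec V x|)}.
  apply: continuous_subspaceT => x.
  by apply: continuous_comp; [exact: vecof_continuous|exact: norm_continuous].
have [c cS' cmin] := EVT_min_rV S0 (bounded_closed_compact bS cS) cf.
exists `|rV_to_vec V c|.
  rewrite normr_gt0 vecof_eq0 ?vbasisP//.
  move: cS'; rewrite inE /S /= => c1; apply/eqP => c0.
  by move: c1; rewrite c0 normr0 => /esym/eqP; rewrite oner_eq0.
move=> x; have [->|x0] := eqVneq x 0.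
  by rewrite normr0 mulr0.
have vecofZ : rV_to_vec V (`|x|^-1 *: x) = `|x|^-1 *: rV_to_vec V x.
  exact: linearZ.
have /mem_set/cmin := S_scale _ x0; rewrite vecofZ normrZ normfV normr_id.
by rewrite ler_pdivlMl ?normr_gt0// mulrC.
Qed.

(** The bound [norm_vecof_ge] makes the coordinates, and then every linear
    function of them, bounded by the norm of [V]. *)
Lemma linear_continuous_fd (V : normedVectType R) (W : normedModType R)
  (f : {linear V -> W}) : continuous f.
Proof.
apply/linear_bounded_continuous/linear_boundedP.
have [m m0 mP] := norm_vecof_ge V.
pose C := \sum_(i < \dim {:V}) `|f (vbasis {:V})`_i|.
have C0 : 0 <= C by apply: sumr_ge0.
have fle v : `|f v| <= C / m * `|v|.
  rewrite -(rVofK (vbasisP {:V}) v); set x := rVof _ v.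
  rewrite [vecof _ _ in X in X <= _]/vecof linear_sum.
  apply: le_trans (ler_norm_sum _ _ _) _.
  apply: (@le_trans _ _ (C * `|x|)).
    rewrite mulr_suml; apply: ler_sum => i _.
    rewrite linearZ normrZ mulrC ler_wpM2l//.
    rewrite [leRHS]/Num.norm/= mx_normrE; apply/bigmax_geP; right => /=.
    by exists (0, i).
  by rewrite -mulrA ler_wpM2l// ler_pdivlMl.
near=> r => v; apply: le_trans (fle v) _.
by rewrite ler_wpM2r//; near: r; apply: nbhs_pinfty_ge; exact: num_real.
Unshelve. all: by end_near. Qed.

Lemma bilinear_continuous_fd (U V : normedVectType R) (W : normedModType R)
  (f : {bilinear U -> V -> W}) : continuous (fun p : U * V => f p.1 p.2).
Proof.
rewrite (_ : (fun p => _) = fun p : U * V =>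
    \sum_(i < \dim {:U}) coord (vbasis {:U}) i p.1 *: f (vbasis {:U})`_i p.2); last first.
  apply/funext => p; rewrite {1}(coord_vbasis (memvf p.1)) linear_sumlz.
  by apply: eq_bigr => i _; rewrite linearZl_LR.
apply: continuous_big => [|i _ p]; first exact: add_continuous.
apply: cvgZ.
- apply: (@continuous_comp _ _ _ fst (coord (vbasis {:U}) i)).
    exact: cvg_fst.
  exact: (@linear_continuous_fd _ _ (coord (vbasis {:U}) i)).
- apply: (@continuous_comp _ _ _ snd (f _)); first exact: cvg_snd.
  exact: linear_continuous_fd.
Qed.

Lemma is_derive_linear (V : normedVectType R) (W : normedModType R)
    (f : {linear V -> W}) (c : R -> V) (t : R) (dc : V) :
  is_derive t 1 c dc -> is_derive t 1 (f \o c) (f dc).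
Proof.
move=> cdc; have dct : differentiable c t by apply/derivable1_diffP.
have dfc : differentiable f (c t).
  by apply: linear_differentiable; exact: linear_continuous_fd.
apply: DeriveDef.
  by apply/derivable1_diffP; exact: differentiable_comp.
rewrite deriveE; last exact: differentiable_comp.
rewrite diff_comp//= diff_lin; last exact: linear_continuous_fd.
by rewrite -deriveE// (@derive_val _ _ _ _ _ _ _ cdc).
Qed.

(** The Leibniz rule; it yields the derivative of [ip W W] along a curve. *)
Lemma is_derive_bilinear (U V : normedVectType R) (W : normedModType R)
    (f : {bilinear U -> V -> W}) (c : R -> U) (d : R -> V) (t : R) dc dd :
  is_derive t 1 c dc -> is_derive t 1 d dd ->
  is_derive t 1 (fun s => f (c s) (d s)) (f (c t) dd + f dc (d t)).
Proof.
move=> cdc ddd.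
have dct : differentiable c t by apply/derivable1_diffP.
have ddt : differentiable d t by apply/derivable1_diffP.
have dp : differentiable (fun s => (c s, d s)) t by exact: differentiable_pair.
pose g := fun p : U * V => f p.1 p.2.
have cg : continuous g := @bilinear_continuous_fd _ _ _ f.
have dg : differentiable g (c t, d t) by exact: differentiable_bilin.
rewrite (_ : (fun s => _) = g \o (fun s => (c s, d s)))//.
apply: DeriveDef.
  by apply/derivable1_diffP; exact: differentiable_comp.
rewrite deriveE; last exact: differentiable_comp.
rewrite diff_comp//= diff_bilin// diff_pair//= -!deriveE//.
by rewrite (@derive_val _ _ _ _ _ _ _ cdc) (@derive_val _ _ _ _ _ _ _ ddd).
Qed.

(** Solutions are only asked to be continuous at time [0], so the derivative is
    given on the open half-line and the mean value theorem does the rest. *)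
Lemma constant_on_half_line (s : R -> R) :
  {within `[0, +oo[, continuous s} ->
  (forall t : R, 0 < t -> is_derive t 1 s 0) ->
  forall t : R, 0 <= t -> s t = s 0.
Proof.
move=> cs ds t t0.
have := @MVT_segment R s (fun=> 0) 0 t t0.
case.
- by move=> x; rewrite in_itv/= => /andP[x0 _]; exact: ds.
- apply: continuous_subspaceW cs => x /=; rewrite !in_itv/= => /andP[-> _]//.
- by move=> c _; rewrite mul0r => /eqP; rewrite subr_eq0 => /eqP.
Qed.

End FiniteDimension.

(** * Skew operators over the complex numbers *)

Lemma mulmx_similar (F : comUnitRingType) n (U D M : 'M[F]_n) :
  U \in unitmx -> M = invmx U *m D *m U -> U *m M = D *m U.
Proof. by move=> Uu ->; rewrite !mulmxA mulmxV// mul1mx. Qed.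

(** The form is taken as a bare function so that it can be the restriction of an
    inner product to a subspace. *)
Section SkewOperators.
Context {R : realType} {V : vectType R} (b : V -> V -> R).
Hypothesis b_linear : forall y, scalar (b^~ y).
Hypothesis b_sym : forall x y, b x y = b y x.
Hypothesis b_pos : forall x, x != 0 -> 0 < b x x.

Let b0 y : b 0 y = 0.
Proof. by have := b_linear y (-1) 0 0; rewrite scaler0 addr0 mulN1r addNr. Qed.

Let bD x x' y : b (x + x') y = b x y + b x' y.
Proof. by have := b_linear y 1 x x'; rewrite scale1r mul1r. Qed.

Let bZ a x y : b (a *: x) y = a * b x y.
Proof. by have := b_linear y a x 0; rewrite addr0 b0 addr0. Qed.

Let b_sum (I : Type) (r : seq I) (P : pred I) (F : I -> V) y :
  b (\sum_(i <- r | P i) F i) y = \sum_(i <- r | P i) b (F i) y.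
Proof. by apply: (big_morph (b^~ y)) => [x x'|]; [exact: bD|exact: b0]. Qed.

(** Gram-Schmidt, one vector at a time; a vector in the span of the previous
    ones is dropped. *)
Lemma orthonormal_seq_span (X : seq V) : exists2 E : seq V,
  uniq E /\ {in E &, forall x y, b x y = (x == y)%:R} & <<E>>%VS = <<X>>%VS.
Proof.
elim: X => [|x X [E [uE bE] spanE]]; first by exists [::].
pose p := \sum_(e <- E) b x e *: e.
have pE : p \in <<E>>%VS.
  by rewrite /p big_seq; apply: memv_suml => e eE; rewrite memvZ// memv_span.
have spanxp : <<x :: X>>%VS = <<(x - p) :: E>>%VS.
  rewrite !span_cons -spanE.
  apply/eqP; rewrite eqEsubv !subv_add !addvSr !andbT -!memvE.
  rewrite -{1}[x](subrK p) memv_add ?memv_line//=.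
  by rewrite memv_add ?memv_line// memvN.
have [xp0|xp0] := eqVneq (x - p) 0.
  by exists E => //; rewrite spanxp xp0 span_cons (addv_idPr _)// -memvE mem0v.
have orthE e : e \in E -> b (x - p) e = 0.
  move=> eE; rewrite bD -scaleN1r bZ mulN1r b_sum (bigD1_seq e)//=.
  rewrite bZ (bE e e)// eqxx mulr1 big_seq_cond big1 ?addr0 ?subrr// => i /andP[iE ie].
  by rewrite bZ (bE i e)// (negPf ie) mulr0.
pose nu := Num.sqrt (b (x - p) (x - p)).
have nu0 : nu != 0 by rewrite sqrtr_eq0 -ltNge b_pos.
pose y := nu^-1 *: (x - p).
have yE e : e \in E -> b y e = 0 by move=> eE; rewrite bZ orthE ?mulr0.
have yy : b y y = 1.
  rewrite bZ b_sym bZ mulrA -[X in _ * X]sqr_sqrtr ?ltW ?b_pos// -/nu.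
  by rewrite -expr2 -exprMn mulVf// expr1n.
exists (y :: E).
  split=> /=.
    rewrite uE andbT; apply/negP => yE'.
    by have /eqP := yE _ yE'; rewrite yy oner_eq0.
  move=> u w; rewrite !inE => /predU1P[->|uE'] /predU1P[->|wE'].
  - by rewrite eqxx yy.
  - rewrite yE//; case: eqP => // yw.
    by have /eqP := yE _ wE'; rewrite -yw yy oner_eq0.
  - rewrite b_sym yE//; case: eqP => // yw.
    by have /eqP := yE _ uE'; rewrite yw yy oner_eq0.
  - exact: bE.
rewrite spanxp !span_cons; congr (_ + _)%VS.
apply/eqP; rewrite eqEsubv -!memvE memvZ ?memv_line//=.
by rewrite -[X in X \in _](scalerKV nu0) memvZ// memv_line.
Qed.

Lemma orthonormal_basis : exists2 E : (\dim {:V}).-tuple V,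
  basis_of {:V} E & forall i j : 'I_(\dim {:V}), b E`_i E`_j = (i == j)%:R.
Proof.
have [E [uE bE]] := orthonormal_seq_span (vbasis {:V}).
rewrite (span_basis (vbasisP _)) => spanE.
have freeE : free E.
  rewrite -[E]/(tval (in_tuple E)); apply/freeP => k /= sum0 i.
  have := congr1 (b^~ E`_i) sum0; rewrite b0 b_sum (bigD1 i)//=.
  rewrite bZ bE ?mem_nth// eqxx mulr1 big1 ?addr0// => j ji.
  by rewrite bZ bE ?mem_nth// nth_uniq// val_eqE (negPf ji) mulr0.
have sizeE : size E == \dim {:V}.
  by move: freeE; rewrite /free spanE => /eqP->.
exists (Tuple sizeE); first by rewrite basisEfree freeE spanE subvv/= (eqP sizeE).
move=> i j /=; rewrite bE ?mem_nth ?(eqP sizeE)//.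
by rewrite nth_uniq ?(eqP sizeE).
Qed.

(** In an orthonormal basis the matrix [K] of [f] satisfies [K^T = - K]; being
    real, it is a normal complex matrix.  The matrix [Q] changes to this basis
    from the one in which [complexified_mx] is written. *)
Lemma skew_diagonalization (f : 'End(V)) :
  (forall x y, b (f x) y = - b x (f y)) ->
  exists P d, [/\ P \in unitmx,
    P *m complexified_mx f = diag_mx d *m P & forall i, complex.Re (d 0 i) = 0].
Proof.
move=> f_skew.
have [E Eb EE] := orthonormal_basis.
have eb := vbasisP {:V}; set e := vbasis {:V} in eb.
pose K := mxof E E f.
have K_skew : K^T = - K.
  have KE i j : K i j = b (f E`_i) E`_j.
    have -> : f E`_i = \sum_k K i k *: E`_k.
      rewrite [LHS](coord_basis Eb) ?memvf//; apply: eq_bigr => k _.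
      by rewrite !mxE /= vecof_delta.
    rewrite b_sum (bigD1 j)//= bZ EE eqxx mulr1 big1 ?addr0// => k kj.
    by rewrite bZ EE (negPf kj) mulr0.
  by apply/matrixP => i j; rewrite mxE [RHS]mxE !KE f_skew b_sym.
pose Q := mxof E e \1%VF.
have Qu : Q \in unitmx.
  suff : Q *m mxof e E \1%VF = 1%:M by case/mulmx1_unit.
  by rewrite -mxof_comp// comp_lfun1l mxof1// (basis_free Eb).
have QM : Q *m mxof e e f = K *m Q.
  by rewrite -!mxof_comp// comp_lfun1l comp_lfun1r.
pose KC := map_mx (real_complex R) K.
have KCstar : map_mx Num.conj KC^T = - KC.
  rewrite /KC map_trmx K_skew !map_mxN -map_mx_comp; congr (- _).
  by apply: eq_map_mx => x /=; exact: conjc_real.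
have KCnormal : KC \is normalmx.
  by apply/normalmxP; rewrite KCstar mulmxN mulNmx.
have /orthomx_spectralP KCE := KCnormal.
set U := spectralmx KC in KCE; set d := spectral_diag KC in KCE.
have Uu : U \in unitmx := spectral_unit KC.
have UKC : U *m KC = diag_mx d *m U := mulmx_similar Uu KCE.
exists (U *m map_mx (real_complex R) Q), d; split.
- by rewrite unitmx_mul Uu map_unitmx.
- by rewrite -mulmxA /complexified_mx -map_mxM QM map_mxM mulmxA UKC -mulmxA.
- move=> i.
  (* The adjoint of U KC U^-1 = diag d, with U unitary and KC skew, is
     conj d = - d. *)
  have Uunit : U \is unitarymx := spectral_unitarymx KC.
  have D : U *m KC *m invmx U = diag_mx d by rewrite UKC mulmxK.
  have := congr1 (fun A => map_mx Num.conj A^T) D.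
  rewrite invmx_unitary// !trmx_mul !map_mxM map_trmx trmxK -map_mx_comp.
  rewrite tr_diag_mx map_diag_mx KCstar.
  rewrite (map_mx_id (@conjCK _)) mulNmx mulmxN mulmxA -invmx_unitary// D.
  move=> /matrixP/(_ i i); rewrite !mxE eqxx !mulr1n => /(congr1 (@complex.Re R)).
  by case: (d 0 i) => x y /= dN; lra.
Qed.

End SkewOperators.

Lemma diagonalizable_of_diag (C : fieldType) n (P M : 'M[C]_n) d :
  P \in unitmx -> P *m M = diag_mx d *m P -> diagonalizable M.
Proof.
move=> Pu PM; exists P => //; apply/similar_diagPex; exists d.
by apply/similarP.
Qed.

Lemma eigenvalue_of_diag (C : fieldType) n (P M : 'M[C]_n) d a :
  P \in unitmx -> P *m M = diag_mx d *m P -> eigenvalue M a ->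
  exists i, a = d 0 i.
Proof.
move=> Pu PM /eigenvalueP[u uM u0].
pose w := u *m invmx P.
have w0 : w != 0.
  by apply: contraNneq u0 => w0; rewrite -[u](mulmxKV Pu) -/w w0 mul0mx.
have wd : w *m diag_mx d = a *: w.
  have -> : diag_mx d = P *m M *m invmx P by rewrite PM mulmxK.
  by rewrite !mulmxA mulmxKV// uM scalemxAl.
clearbody w; have /rV0Pn[i wi] := w0.
exists i; have /rowP/(_ i) := wd; rewrite mul_mx_diag !mxE mulrC => /eqP.
by rewrite -subr_eq0 -mulrBl mulf_eq0 (negPf wi) orbF subr_eq0 => /eqP.
Qed.

(** * Linear flows with imaginary spectrum *)

Section LinearFlow.
Context {R : realType}.
Local Notation C := R[i].

Lemma Re_sum (I : Type) (r : seq I) (F : I -> C) :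
  complex.Re (\sum_(i <- r) F i) = \sum_(i <- r) complex.Re (F i).
Proof. by apply: (big_morph (@complex.Re R)) => [[? ?] [? ?]|]. Qed.

Lemma Re_mul_real (z : C) (x : R) :
  complex.Re (z * real_complex R x) = complex.Re z * x.
Proof. by case: z => a b /=; rewrite mulr0 subr0. Qed.

Let cis (th : R) : C := Complex (cos th) (sin th).

Lemma is_derive_Re_cis (z : C) (th t : R) :
  is_derive t 1 (fun s => complex.Re (z * cis (th * s)))
    (complex.Re (z * cis (th * t) * Complex 0 th)).
Proof.
case: z => a b; rewrite /cis /=.
have dth : is_derive t 1 (fun s : R => th * s) th.
  by apply: is_derive_eq; rewrite /GRing.scale/= mulr1.
have dc : is_derive t 1 (fun s : R => cos (th * s)) (- sin (th * t) * th).
  exact: (@is_derive1_comp _ cos (fun s => th * s)).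
have ds : is_derive t 1 (fun s : R => sin (th * s)) (cos (th * t) * th).
  exact: (@is_derive1_comp _ sin (fun s => th * s)).
have da : is_derive t 1 (fun s : R => a * cos (th * s)) (a * (- sin (th * t) * th)).
  exact: is_deriveZ.
have db : is_derive t 1 (fun s : R => b * sin (th * s)) (b * (cos (th * t) * th)).
  exact: is_deriveZ.
apply: (is_derive_eq (is_deriveB da db)); ring.
Qed.

(** If [P M P^-1 = diag (i theta_k)], the solution of [x' = x M] from [u0] is
    [u0 P^-1 diag (exp (i theta_k t)) P].  Its real part is taken here: it solves
    the same equation because [M] is real. *)
Lemma linear_flow n (M : 'M[R]_n) (P : 'M[C]_n) (d : 'rV[C]_n) (u0 : 'rV[R]_n) :
  P \in unitmx -> P *m map_mx (real_complex R) M = diag_mx d *m P ->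
  (forall i, complex.Re (d 0 i) = 0) ->
  exists2 x : R -> 'rV[R]_n, x 0 = u0 &
    forall (t : R) i, is_derive t 1 (fun s => x s 0 i) ((x t *m M) 0 i).
Proof.
move=> Pu PM Red.
pose a := map_mx (real_complex R) u0 *m invmx P.
pose th k := complex.Im (d 0 k).
pose s t := \row_k (a 0 k * cis (th k * t)).
pose x t := \row_i complex.Re ((s t *m P) 0 i).
have dE k : d 0 k = Complex 0 (th k).
  by rewrite /th -(Red k); case: (d 0 k).
have sE t k : s t 0 k = a 0 k * cis (th k * t) by rewrite mxE.
exists x.
  apply/rowP => i; rewrite mxE (_ : s 0 = a) /a ?mulmxKV ?mxE//.
  by apply/rowP => k; rewrite mxE mulr0 /cis cos0 sin0; exact: mulr1.
move=> t i.
have xE : (fun r => x r 0 i) = \sum_(k < n) fun r =>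
    complex.Re (a 0 k * P k i * cis (th k * r)).
  apply/funext => r; rewrite mxE mxE Re_sum fct_sumE.
  by apply: eq_bigr => k _; rewrite mxE mulrAC.
rewrite xE; apply: is_derive_eq.
  exact: (is_derive_sum (fun k => is_derive_Re_cis (a 0 k * P k i) (th k) t)).
transitivity (complex.Re ((s t *m P *m map_mx (real_complex R) M) 0 i)).
  rewrite -mulmxA PM mulmxA mxE Re_sum; apply: eq_bigr => k _.
  rewrite mul_mx_diag [X in _ = complex.Re (X * _)]mxE sE dE.
  by congr complex.Re; rewrite [RHS]mulrAC; congr (_ * _); exact: mulrAC.
rewrite mxE [RHS]mxE Re_sum; apply: eq_bigr => k _.
by rewrite [map_mx _ _ _ _]mxE Re_mul_real [x t 0 k]mxE.
Qed.
End LinearFlow.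

(** * Vector-valued derivatives *)

Lemma is_derive_translate (R : numFieldType) (V W : normedModType R)
    (f : V -> W) (a v : V) (df : W) :
  is_derive 0 v (fun x => f (x + a)) df -> is_derive a v f df.
Proof.
have quotE : (fun h : R => h^-1 *: (f (h *: v + a) - f a)) =
    (fun h => h^-1 *: (f (h *: v + 0 + a) - f (0 + a))).
  by apply/funext => h; rewrite addr0 add0r.
by case=> ex val; split; rewrite /derivable /derive /= ?quotE.
Qed.

Lemma is_derive_0_const (R : realType) (V : normedVectType R) (h : R -> V) (y : V) :
  (forall s : R, is_derive s 1 h 0) -> h 0 = y -> h = cst y.
Proof.
move=> dh h0; apply/funext => t /=; rewrite -h0.
apply: (can_inj (rVofK (vbasisP {:V}))); apply/rowP => i; rewrite !mxE.
apply: (@is_derive_0_is_cst _ (coord (vbasis {:V}) i \o h)) => s.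
by apply: is_derive_eq; first exact: is_derive_linear; rewrite linear0.
Qed.

Lemma is_derive_scalel (R : realType) (V : normedModType R) (k : R -> R)
    (v : V) (t dk : R) :
  is_derive t 1 k dk -> is_derive t 1 (fun s : R => k s *: v) (dk *: v).
Proof.
move=> kdk; have dkt : differentiable k t by apply/derivable1_diffP.
apply: DeriveDef; first by apply/derivable1_diffP; exact: differentiableZl.
rewrite deriveE; last exact: differentiableZl.
by rewrite diffZl// -deriveE// (@derive_val _ _ _ _ _ _ _ kdk).
Qed.

(** * Two-step Lie groups *)

Section LieGroup.
Context {R : realType} {g : normedVectType R} {lb : {bilinear g -> g -> g}}
  {G : topologicalGroupType} {exp : g -> G} {Ad : G -> 'End(g)}.
Hypothesis lieG : lie_group_with_lie_algebra lb exp Ad.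
Implicit Types (p q : G) (X Y W : g).

Lemma exp0 : exp 0 = 1%g.
Proof.
have := exp_ray lieG 0 0 0; rewrite !scaler0 => e.
by apply: (mulgI (exp 0)); rewrite -e mulg1.
Qed.

(** [exp] is injective only near [0], but a ray is determined by its points
    near [0]. *)
Lemma exp_ray_inj X Y : (forall t : R, exp (t *: X) = exp (t *: Y)) -> X = Y.
Proof.
move=> eXY; have [U [oU Uinj _]] := exp_local_homeo lieG.
have nU : nbhs (0 : g) U by exact: open_nbhs_nbhs.
have scale0 Z : \forall t \near (0 : R), U (t *: Z).
  suff : t *: Z @[t --> (0 : R)] --> (0 : g) by apply.
  by rewrite -[X in _ --> X](scale0r Z); apply: (@cvgZr_tmp _ _ _ (nbhs (0 : R))); exact: cvg_id.
have : \forall t \near (0 : R)^', t *: X = t *: Y /\ t != 0.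
  near=> t; split; last by near: t; exact: nbhs_dnbhs_neq.
  apply: Uinj => //; near: t; apply: nbhs_dnbhs; exact: scale0.
move=> /filter_ex[t [tXY t0]].
exact: (scalerI t0).
Unshelve. all: by end_near. Qed.

Lemma AdM p q X : Ad (p * q)%g X = Ad p (Ad q X).
Proof.
apply: exp_ray_inj => t; rewrite -!linearZ -!(exp_Ad lieG).
by rewrite invgM !mulgA.
Qed.

Lemma Ad1 X : Ad 1%g X = X.
Proof.
apply: exp_ray_inj => t.
by rewrite -linearZ -(exp_Ad lieG) invg1 mulg1 mul1g.
Qed.

(** [Ad] turns the one-parameter group [exp (s *: X)] into a one-parameter group
    of operators, so its derivative at [0] determines the derivative at [t]. *)
Lemma is_derive_Ad_exp X Y (t : R) :
  is_derive t 1 (fun s : R => Ad (exp (s *: X)) Y) (Ad (exp (t *: X)) (lb X Y)).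
Proof.
have d0 := ad_bracket lieG X Y.
pose c := fun s : R => Ad (exp (s *: X)) Y.
have dt : is_derive (0 : R) 1 (fun s => c (s + t)) (Ad (exp (t *: X)) (lb X Y)).
  rewrite (_ : (fun s => _) = Ad (exp (t *: X)) \o c).
    exact: is_derive_linear.
  by apply/funext => s; rewrite /c /= -AdM addrC (exp_ray lieG).
exact: (is_derive_translate dt).
Qed.

(** [Ad (exp (t *: X))] fixes [lb X Y], by the differential equation of
    [is_derive_Ad_exp]; the same equation for [Y] then has a constant right-hand
    side. *)
Lemma Ad_exp_step2 X Y : lb X (lb X Y) = 0 -> Ad (exp X) Y = Y + lb X Y.
Proof.
move=> lb2.
have Ad_lb (t : R) : Ad (exp (t *: X)) (lb X Y) = lb X Y.
  have eq0 : (fun s : R => Ad (exp (s *: X)) (lb X Y)) = cst (lb X Y).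
    apply: is_derive_0_const => [s|]; last by rewrite scale0r exp0 Ad1.
    by apply: is_derive_eq (is_derive_Ad_exp X (lb X Y) s) _; rewrite lb2 linear0.
  exact: (congr1 (fun h => h t) eq0).
pose h (t : R) : g := Ad (exp (t *: X)) Y - t *: lb X Y.
have eqh : h = cst Y.
  apply: is_derive_0_const => [s|]; last first.
    by rewrite /h !scale0r exp0 Ad1 subr0.
  rewrite (_ : h = (fun s => Ad (exp (s *: X)) Y) - (fun s => s *: lb X Y))//.
  apply: is_derive_eq.
    apply: is_deriveB; first exact: is_derive_Ad_exp.
    exact: is_derive_scalel.
  by rewrite Ad_lb scale1r subrr.
have := congr1 (fun h => h 1) eqh; rewrite /h !scale1r => /eqP.
by rewrite subr_eq => /eqP.
Qed.

(** Lets neighbourhoods in an orbit, defined by [q] near [1], be read off in the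
    Lie algebra. *)
Lemma near_exp (Q : set G) :
  (\forall q \near (1%g : G), Q q) <-> (\forall X \near (0 : g), Q (exp X)).
Proof.
split=> [nQ|].
  have cexp : {for 0, continuous exp} := @exp_continuous _ _ _ _ _ _ lieG 0.
  by apply: cexp; rewrite exp0.
have [U [oU Uinj Uopen]] := exp_local_homeo lieG.
have nU : nbhs (0 : g) U by exact: open_nbhs_nbhs.
move=> nQ.
have : nbhs (0 : g) (U `&` (exp @^-1` Q)) by exact: filterI.
rewrite nbhsE => -[A [oA A0] AUQ].
have oeA : open (exp @` A) by apply: Uopen => // x /AUQ[].
apply: (@filterS _ _ _ (exp @` A)); first by move=> _ [x /AUQ[_ ?] <-].
by apply: open_nbhs_nbhs; split => //; rewrite -exp0; exists 0.
Qed.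

End LieGroup.

(** * Flows inside a subspace *)

Section SubspaceFlow.
Context {R : realType} {g : normedVectType R} {T : {vspace g}}.

(** Solving in coordinates of [T] gives a solution that stays in [T]. *)
Lemma subspace_flow (f : 'End(subvs_of T)) P d (W0 : g) :
  P \in unitmx -> P *m complexified_mx f = diag_mx d *m P ->
  (forall i, complex.Re (d 0 i) = 0) -> W0 \in T ->
  exists2 w : R -> subvs_of T, vsval (w 0) = W0 &
    forall t : R, is_derive t 1 (vsval \o w) (vsval (f (w t))).
Proof.
move=> Pu PM Red W0T; pose e := vbasis {:subvs_of T}.
have eb : basis_of {:subvs_of T} e := vbasisP _.
have [x x0 dx] := linear_flow (rVof e (vsproj T W0)) Pu PM Red.
exists (fun t => vecof e (x t)); first by rewrite x0 rVofK// vsprojK.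
move=> t; rewrite (hom_vecof e eb) /vecof linear_sum.
rewrite (_ : _ \o _ = \sum_(i < \dim {:subvs_of T})
    fun s => x s 0 i *: vsval e`_i); last first.
  apply/funext => s; rewrite fct_sumE /= linear_sum.
  by apply: eq_bigr => i _; rewrite linearZ.
apply: is_derive_eq.
  exact: (is_derive_sum (fun i => is_derive_scalel (vsval e`_i) (dx t i))).
by apply: eq_bigr => i _; rewrite linearZ.
Qed.

End SubspaceFlow.

(** * Inner products on a normed space *)

Section InnerProduct.
Context {R : realType} {g : normedVectType R} (ip : {dot g for idfun}).

Lemma dot_sym X Y : ip X Y = ip Y X.
Proof. by rewrite hermC expr0 mul1r. Qed.

Lemma dot_scalar Y : scalar (ip^~ Y).
Proof. by move=> a X X'; rewrite linearPl. Qed.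

Lemma dot_inj X Y : (forall W, ip X W = ip Y W) -> X = Y.
Proof.
move=> eXY; apply/eqP; rewrite -subr_eq0; apply/negPn/negP => /(@neq0_dnorm_gt0 _ _ _ ip).
by rewrite linearBl /= eXY subrr ltxx.
Qed.

(** An inner product is scalar-valued; viewing the scalars as the module [R^o]
    lets the results on vector-valued bilinear maps apply to it. *)
Definition dot_bilinear (X Y : g) : R^o := ip X Y.

Fact dot_bilinear_is_bilinear : bilinear_for *:%R *:%R dot_bilinear.
Proof.
split=> [Y a X X'|X a Y Y']; rewrite /dot_bilinear; first exact: dot_scalar.
by rewrite /= ![ip X _]dot_sym dot_scalar.
Qed.

HB.instance Definition _ := bilinear_isBilinear.Build R g g R^o *:%R *:%R
  dot_bilinear dot_bilinear_is_bilinear.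

Lemma dot_square_continuous : continuous (fun X => dot_bilinear X X).
Proof.
move=> X; apply: (@continuous_comp _ _ _ (fun X => (X, X))
  (fun p => dot_bilinear p.1 p.2)); last exact: bilinear_continuous_fd.
exact: (@cvg_pair _ _ _ (nbhs X) (nbhs X) (nbhs X) _ _ _ id id).
Qed.

(** In an orthonormal basis every coordinate of [W] is bounded, in absolute
    value, by the square root of [ip W W]. *)
Lemma norm_le_dot : exists2 C : R, 0 < C & forall W, `|W| <= C * Num.sqrt (ip W W).
Proof.
have [E Eb EE] := orthonormal_basis dot_scalar dot_sym (@neq0_dnorm_gt0 _ _ _ ip).
pose C := \sum_(i < \dim {:g}) `|E`_i|.
have C0 : 0 <= C by exact: sumr_ge0.
exists (C + 1); first by rewrite ltr_pwDr.
move=> W; apply: (@le_trans _ _ (C * Num.sqrt (ip W W))); last first.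
  by rewrite ler_wpM2r ?sqrtr_ge0// lerDl.
rewrite {1}(coord_basis Eb (memvf W)) mulr_suml.
apply: le_trans (ler_norm_sum _ _ _) _; apply: ler_sum => i _.
rewrite normrZ mulrC ler_wpM2l// -sqrtr_sqr ler_wsqrtr//.
have WE (k : 'I_(\dim {:g})) : ip W E`_k = coord E k W.
  rewrite {1}(coord_basis Eb (memvf W)) linear_sumlz (bigD1 k)//=.
  rewrite linearZl_LR /= EE eqxx mulr1 big1 ?addr0// => l lk.
  by rewrite linearZl_LR /= EE (negPf lk) mulr0.
have termE k : ip (coord E k W *: E`_k) W = coord E k W ^+ 2.
  by rewrite linearZl_LR/= dot_sym WE expr2.
rewrite {2}(coord_basis Eb (memvf W)) linear_sumlz (bigD1 i)//= termE.
by rewrite lerDl sumr_ge0// => k _; rewrite termE sqr_ge0.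
Qed.

End InnerProduct.

(** * Conserved linear quantities *)

Lemma linear_image_constant (R : realType) (V W : normedVectType R)
    (L : {linear V -> W}) (c dc : R -> V) :
  {within `[0, +oo[, continuous c} ->
  (forall t : R, 0 < t -> is_derive t 1 c (dc t)) ->
  (forall t : R, 0 < t -> L (dc t) = 0) ->
  forall t : R, 0 <= t -> L (c t) = L (c 0).
Proof.
move=> cc cdc Ldc t t0.
apply: (can_inj (rVofK (vbasisP {:W}))); apply/rowP => i; rewrite !mxE.
pose l := coord (vbasis {:W}) i : {linear W -> R^o}.
apply: (@constant_on_half_line _ (l \o (L \o c))) => // [|s s0].
  apply: within_continuous_comp; last apply: within_continuous_comp => //.
  - by move=> y _; exact: linear_continuous_fd.
  - by move=> y _; exact: linear_continuous_fd.
apply: is_derive_eq.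
  apply: (@is_derive_linear _ _ _ l (L \o c)).
  exact: is_derive_linear (cdc s s0).
by rewrite Ldc// linear0.
Qed.

(** * The Lie-Poisson equation *)

Definition embed_v {R : realType} {v z : normedVectType R} (V : v) : v * z := (V, 0).

Fact embed_v_is_linear {R : realType} {v z : normedVectType R} :
  linear (@embed_v R v z).
Proof. by move=> a V V'; rewrite /embed_v; congr pair; rewrite /= scaler0 addr0. Qed.

HB.instance Definition _ {R : realType} {v z : normedVectType R} :=
  GRing.isLinear.Build R v (v * z)%type _ (@embed_v R v z) embed_v_is_linear.

(** The Lie-Poisson field is quadratic: it is this bilinear map evaluated at the
    two components of a point. *)
Definition lie_poisson_bilinear {R : realType} {v z : normedVectType R}
  (j : {linear z -> 'End(v)}) (V : v) (Z : z) : v * z := embed_v (j Z V).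

Fact lie_poisson_is_bilinear {R : realType} {v z : normedVectType R}
  (j : {linear z -> 'End(v)}) :
  bilinear_for *:%R *:%R (lie_poisson_bilinear j).
Proof.
rewrite /lie_poisson_bilinear; split=> [Z a V V'|V a Z Z'] /=.
  by rewrite !linearP.
by rewrite linearP add_lfunE scale_lfunE linearP.
Qed.

HB.instance Definition _ {R : realType} {v z : normedVectType R}
    (j : {linear z -> 'End(v)}) :=
  bilinear_isBilinear.Build R v z (v * z)%type *:%R *:%R
    (lie_poisson_bilinear j) (lie_poisson_is_bilinear j).

Section LiePoissonStability.
Context {R : realType} {v z : normedVectType R}
  {brz : {bilinear z -> z -> z}} {j : {linear z -> 'End(v)}}
  {ip : {dot (v * z)%type for idfun}}
  {lb : {bilinear (v * z)%type -> (v * z)%type -> (v * z)%type}}.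
Hypothesis modH : arises_from_semisimple_module brz j ip lb.
Implicit Types (X Y W : v * z).

Lemma differentiable_lie_poisson Y : differentiable (lie_poisson j) Y.
Proof.
exact: (@differentiable_bilin _ _ _ _ (lie_poisson_bilinear j) _
  (@bilinear_continuous_fd _ _ _ _ (lie_poisson_bilinear j))).
Qed.

Lemma diff_lie_poisson Y W :
  'd (lie_poisson j) Y W = (j Y.2 W.1 + j W.2 Y.1, 0).
Proof.
have := @diff_bilin _ _ _ _ (lie_poisson_bilinear j) Y
  (@bilinear_continuous_fd _ _ _ _ (lie_poisson_bilinear j)).
move=> /(congr1 (fun h => h W)) /=.
rewrite -[X in X = _ -> _]/('d (lie_poisson j) Y W) => ->.
by rewrite addrC /lie_poisson_bilinear -linearD.
Qed.

Lemma dot_v_component X V : ip X (V, 0) = ip (X.1, 0) (V, 0).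
Proof.
have -> : X = (X.1, 0) + (0, X.2).
  by case: X => X1 X2 /=; congr pair; rewrite /= ?addr0 ?add0r.
by rewrite !linearDl /= addr0 (dot_sym ip (0, _)) (module_orthogonal modH) addr0.
Qed.

Lemma dot_z_component X Z : ip X (0, Z) = ip (0, X.2) (0, Z).
Proof.
have -> : X = (X.1, 0) + (0, X.2).
  by case: X => X1 X2 /=; congr pair; rewrite /= ?addr0 ?add0r.
by rewrite !linearDl /= add0r (module_orthogonal modH) add0r.
Qed.

Lemma dot_bracket X X' Y : ip (lb X X') Y = ip (j Y.2 X.1, 0) X'.
Proof.
rewrite [RHS]dot_sym dot_v_component [RHS]dot_sym -(bracketE modH).
rewrite [LHS]dot_sym [RHS]dot_sym.
have -> : lb X X' = (0, (lb X X').2).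
  by rewrite -(bracket_in_center modH X X'); case: (lb X X').
by rewrite dot_z_component.
Qed.

(** Brackets have no component in [v], and the bracket only sees the components
    in [v] of its arguments. *)
Lemma bracket_step2 X Y : lb X (lb X Y) = 0.
Proof.
apply: (@dot_inj _ _ ip) => W; rewrite dot_bracket linear0l.
by rewrite dot_sym dot_v_component (bracket_in_center modH) linear0l.
Qed.

Lemma j_skew Z V V' : ip (j Z V, 0) (V', 0) = - ip (V, 0) (j Z V', 0).
Proof. by apply/eqP; rewrite -addr_eq0 (module_skew modH). Qed.

Context {G : topologicalGroupType} {exp : v * z -> G}
  {Ad : G -> 'End((v * z)%type)}.
Hypothesis lieG : lie_group_with_lie_algebra lb exp Ad.

(** Transposing [W |-> W + lb X W] through [dot_bracket] gives a translation. *)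
Lemma coadjoint_expP X Y Y' :
  coadjoint ip Ad (exp X) Y Y' <-> Y' = Y + (j Y.2 X.1, 0).
Proof.
have AdE W : ip Y (Ad (exp X) W) = ip (Y + (j Y.2 X.1, 0)) W.
  rewrite (Ad_exp_step2 lieG (bracket_step2 X W)).
  by rewrite dot_sym !linearDl /= dot_bracket (dot_sym ip W).
split=> [co|-> W]; last by rewrite AdE.
by apply: (@dot_inj _ _ ip) => W; rewrite co AdE.
Qed.

Section AtPoint.
Variable Y : v * z.

Definition orbit_tangent : {vspace v * z} := limg (linfun embed_v \o j Y.2)%VF.
Local Notation T := orbit_tangent.

Lemma orbit_tangentP W : reflect (exists V, W = (j Y.2 V, 0)) (W \in T).
Proof.
apply: (iffP memv_imgP) => [[V _ ->]|[V ->]]; exists V; rewrite ?memvf//.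
- by rewrite comp_lfunE lfunE.
- by rewrite comp_lfunE lfunE.
Qed.

(** By [coadjoint_expP] a one-parameter subgroup moves [Y] along a straight line. *)
Lemma orbit_tangent_velocity : coadjoint_orbit_tangent ip exp Ad Y T.
Proof.
move=> W.
have curve X : is_derive (0 : R) 1 (fun t : R => Y + t *: (j Y.2 X.1, 0))
    ((j Y.2 X.1, 0) : v * z).
  have dY : is_derive (0 : R) 1 (cst Y) 0 by exact: is_derive_cst.
  have dl : is_derive (0 : R) 1 (fun t : R => t *: ((j Y.2 X.1, 0) : v * z))
      (1 *: ((j Y.2 X.1, 0) : v * z)).
    by apply: is_derive_scalel; exact: is_derive_id.
  by apply: (is_derive_eq (is_deriveD dY dl)); rewrite add0r scale1r.
have curveP X (t : R) : Y + (j Y.2 (t *: X).1, 0) = Y + t *: (j Y.2 X.1, 0).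
  by congr (_ + _); congr pair; rewrite /= ?scaler0// linearZ.
split=> [/orbit_tangentP[V ->]|[X [c [co dc]]]].
  exists (V, 0), (fun t => Y + t *: (j Y.2 V, 0)); split; last exact: (curve (V, 0)).
  by move=> t; apply/coadjoint_expP; rewrite curveP.
have cE : c = fun t : R => Y + t *: (j Y.2 X.1, 0).
  by apply/funext => t; have /coadjoint_expP -> := co t; rewrite curveP.
apply/orbit_tangentP; exists X.1.
by rewrite -(@derive_val _ _ _ _ _ _ _ dc) cE (@derive_val _ _ _ _ _ _ _ (curve X)).
Qed.

Definition tangent_linearization : 'End(subvs_of T) :=
  linfun (vsproj T \o ('d (lie_poisson j) Y : v * z -> v * z) \o vsval).

Lemma tangent_linearizationE (W : subvs_of T) :
  vsval (tangent_linearization W) = 'd (lie_poisson j) Y (vsval W).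
Proof.
rewrite lfunE /= vsprojK//; have /orbit_tangentP[V ->] := valP W.
rewrite diff_lie_poisson /= linear0 zero_lfunE addr0.
by apply/orbit_tangentP; exists (j Y.2 V).
Qed.

Lemma tangent_linearization_skew (W W' : subvs_of T) :
  ip (vsval (tangent_linearization W)) (vsval W') =
  - ip (vsval W) (vsval (tangent_linearization W')).
Proof.
rewrite !tangent_linearizationE.
have /orbit_tangentP[V ->] := valP W; have /orbit_tangentP[V' ->] := valP W'.
by rewrite !diff_lie_poisson /= linear0 !zero_lfunE !addr0 j_skew.
Qed.

Lemma tangent_linearization_diag : exists P d, [/\ P \in unitmx,
    P *m complexified_mx tangent_linearization = diag_mx d *m P &
    forall i, complex.Re (d 0 i) = 0].
Proof.
pose b (W W' : subvs_of T) := ip (vsval W) (vsval W').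
apply: (@skew_diagonalization R (subvs_of T) b).
- move=> W' a W1 W2; exact: (dot_scalar ip (vsval W') a (vsval W1) (vsval W2)).
- by move=> W W'; exact: dot_sym.
- move=> W W0; apply: neq0_dnorm_gt0; apply: contra_neq W0 => W0.
  by apply: val_inj; rewrite /= W0.
- exact: tangent_linearization_skew.
Qed.

Lemma lie_poisson_elliptic : elliptic_on_orbit ip exp Ad (lie_poisson j) Y.
Proof.
split; first exact: differentiable_lie_poisson.
exists T; first exact: orbit_tangent_velocity.
exists tangent_linearization; first exact: tangent_linearizationE.
have [P [d [Pu PM Red]]] := tangent_linearization_diag.
split; first exact: diagonalizable_of_diag PM.
by move=> a /(eigenvalue_of_diag Pu PM)[i ->].
Qed.

Hypothesis eqY : lie_poisson j Y = 0.

Let eqY1 : j Y.2 Y.1 = 0.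
Proof. by move: eqY => []. Qed.

(** The field is bilinear in the two components and vanishes at [Y], so on the affine space
    [Y + T] it has no term beyond the linear one. *)
Lemma lie_poisson_shift W : W.2 = 0 ->
  lie_poisson j (Y + W) = 'd (lie_poisson j) Y W.
Proof.
move=> W2; rewrite diff_lie_poisson W2 linear0 zero_lfunE addr0.
by rewrite /lie_poisson /= W2 addr0 linearD /= eqY1 add0r.
Qed.

Lemma tangent_snd W : W \in T -> W.2 = 0.
Proof. by case/orbit_tangentP => V ->. Qed.

(** A small [W] in [T] is [(j Y.2 V, 0)] for a small [V], chosen by a linear, hence
    continuous, section of [j Y.2]; thus [Y + W] is the image of [Y] under the
    element [exp (V, 0)], which is close to [1]. *)
Lemma orbit_nbhs_dot_ball U : coadjoint_orbit_nbhs ip Ad Y U ->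
  exists2 e : R, 0 < e & forall W, W \in T -> ip W W < e -> U (Y + W).
Proof.
move=> /(near_exp lieG) nU.
pose inv : {linear (v * z)%type -> (v * z)%type} :=
  linfun embed_v \o (j Y.2)^-1%VF \o fst.
have : \forall W \near (0 : v * z),
    forall Y', coadjoint ip Ad (exp (inv W)) Y Y' -> U Y'.
  have cinv : {for 0, continuous inv} := @linear_continuous_fd _ _ _ inv 0.
  have nU0 : nbhs (inv 0)
      [set X | forall Y', coadjoint ip Ad (exp X) Y Y' -> U Y'].
    by rewrite linear0.
  exact: (cinv _ nU0).
move=> /nbhs_ballP[r /= r0 rU].
have [C C0 leC] := norm_le_dot ip.
exists ((r / C) ^+ 2); first by rewrite exprn_gt0// divr_gt0.
move=> W WT We; apply: (rU W).
  rewrite -ball_normE /= sub0r normrN; apply: le_lt_trans (leC W) _.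
  rewrite mulrC -ltr_pdivlMr// -[ltRHS]ger0_norm ?divr_ge0 ?ltW//.
  by rewrite -sqrtr_sqr ltr_sqrt// exprn_gt0// divr_gt0.
apply/coadjoint_expP; congr (_ + _).
have /orbit_tangentP[V ->] := WT.
by rewrite /= lfunE /= limg_lfunVK// memv_img// memvf.
Qed.

Lemma dot_ball_orbit_nbhs (e : R) : 0 < e -> coadjoint_orbit_nbhs ip Ad Y
  [set Y' | exists2 W, W \in T & Y' = Y + W /\ ip W W < e].
Proof.
move=> e0; apply/(near_exp lieG).
pose f : {linear (v * z)%type -> (v * z)%type} := linfun embed_v \o j Y.2 \o fst.
pose N X : R := dot_bilinear ip (f X) (f X).
have cN : {for 0, continuous N}.
  apply: (@continuous_comp _ _ _ f (fun X => dot_bilinear ip X X)).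
    exact: linear_continuous_fd.
  exact: dot_square_continuous.
have nearN : \forall X \near (0 : v * z), N X < e.
  apply: (cN [set x | x < e]); apply: lt_nbhsl.
  by rewrite /N linear0 linear0l.
apply: filterS nearN => X NX Y' /coadjoint_expP ->.
exists (j Y.2 X.1, 0); first by apply/orbit_tangentP; exists X.1.
by split=> //; move: NX; rewrite /N /f /= lfunE.
Qed.

Lemma solution_exists W0 : W0 \in T ->
  exists2 c, solution_on_orbit ip Ad (lie_poisson j) Y c & c 0 = Y + W0.
Proof.
move=> W0T; have [P [d [Pu PM Red]]] := tangent_linearization_diag.
have [w w0 dw] := subspace_flow Pu PM Red W0T.
have dc (t : R) : is_derive t 1 (fun t => Y + vsval (w t))
    (lie_poisson j (Y + vsval (w t))).
  have dY : is_derive t 1 (cst Y) 0 by exact: is_derive_cst.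
  apply: (is_derive_eq (is_deriveD dY (dw t))).
  by rewrite add0r tangent_linearizationE lie_poisson_shift// tangent_snd ?subvsP.
exists (fun t => Y + vsval (w t)); last by rewrite w0.
split=> [t _||t _]; last exact: dc.
  have /orbit_tangentP[V ->] := subvsP (w t).
  by exists (exp (V, 0)); apply/coadjoint_expP.
apply: continuous_subspaceT => t; apply: differentiable_continuous.
exact/derivable1_diffP/(@ex_derive _ _ _ _ _ _ _ (dc t)).
Qed.

(** The central component of [c] has zero velocity.  The velocity in [v] lies in
    the image of [j Y.2], so the projection along this image is conserved and
    [c t - Y] cannot leave [T].  Skewness gives [ip] of the velocity with
    [c t - Y] equal to [0]. *)
Lemma solution_invariants W0 c : W0 \in T ->
    solution_on_orbit ip Ad (lie_poisson j) Y c -> c 0 = Y + W0 ->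
  forall t : R, 0 <= t ->
    c t - Y \in T /\ ip (c t - Y) (c t - Y) = ip W0 W0.
Proof.
move=> W0T [_ cc dc] c0.
have c2 (t : R) : 0 <= t -> (c t).2 = Y.2.
  move=> t0; have := linear_image_constant (L := snd) cc dc _ t0.
  by rewrite c0 /= (tangent_snd W0T) addr0; apply.
have FE (t : R) : 0 < t -> lie_poisson j (c t) = (j Y.2 (c t - Y).1, 0).
  by move=> t0; rewrite /lie_poisson c2 ?ltW// linearB /= eqY1 subr0.
have cT (t : R) : 0 <= t -> c t - Y \in T.
  move=> t0.
  (* p vanishes exactly on the image of j Y.2. *)
  pose p : {linear v -> v} := idfun \- (j Y.2 \o (j Y.2)^-1%VF).
  have pj V : p (j Y.2 V) = 0.
    by rewrite /p /= limg_lfunVK ?subrr// memv_img ?memvf.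
  pose L : {linear (v * z)%type -> v} := p \o fst.
  have Lc : L (c t) = L (c 0).
    apply: (linear_image_constant cc dc) => // s s0.
    rewrite FE//; exact: pj.
  have : p (c t - Y).1 = 0.
    have L0 : L (c 0) = L Y.
      rewrite c0 linearD; have /orbit_tangentP[V ->] := W0T.
      by rewrite [X in _ + X]pj addr0.
    by rewrite -[LHS]/(L (c t - Y)) linearB Lc L0 subrr.
  rewrite /p /= => /eqP; rewrite subr_eq0 => /eqP pE.
  apply/orbit_tangentP; exists ((j Y.2)^-1%VF (c t - Y).1); rewrite -pE.
  by rewrite [LHS]surjective_pairing /= c2// subrr.
move=> t t0; split; first exact: cT.
have -> : W0 = c 0 - Y by rewrite c0 addrAC subrr add0r.
pose D := fun s => c s - Y.
pose N (s : R) : R := dot_bilinear ip (D s) (D s).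
apply: (@constant_on_half_line _ N) => // [|s s0].
  rewrite (_ : N = ((fun X => dot_bilinear ip X X) \o (fun X => X - Y)) \o c)//.
  apply: within_continuous_comp cc => X _.
  apply: continuous_comp; last exact: dot_square_continuous.
  by apply: (@cvgB _ _ _ (nbhs X)); [exact: cvg_id|exact: cvg_cst].
have dY : is_derive s 1 (cst Y) 0 by exact: is_derive_cst.
have dD : is_derive s 1 D (lie_poisson j (c s)).
  by apply: (is_derive_eq (is_deriveB (dc s s0) dY)); rewrite subr0.
apply: (is_derive_eq (is_derive_bilinear (dot_bilinear ip) dD dD)).
rewrite FE// /dot_bilinear -/(D s).
have /orbit_tangentP[V DV] : D s \in T := cT s (ltW s0); rewrite DV.
by rewrite [X in X + _]dot_sym /= {1}j_skew [X in _ + X]dot_sym addNr.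
Qed.

(** The balls [ip W W < e] in [Y + T] are invariant neighbourhoods. *)
Lemma lie_poisson_stable : lyapunov_stable_on_orbit ip Ad (lie_poisson j) Y.
Proof.
move=> U /orbit_nbhs_dot_ball[e e0 eU].
eexists; first exact: (dot_ball_orbit_nbhs e0).
move=> Y0 _ [W0 W0T [-> W0e]]; split; first exact: solution_exists.
move=> c solc c0 t t0.
have [cT cN] := solution_invariants W0T solc c0 t0.
by rewrite -(subrK Y (c t)) addrC; apply: eU; rewrite ?cN.
Qed.

End AtPoint.
End LiePoissonStability.

Theorem proposition3p10 (R : realType) (v z : normedVectType R)
  (brz : {bilinear z -> z -> z}) (j : {linear z -> 'End(v)})
  (ip : {dot (v * z)%type for idfun})
  (lb : {bilinear (v * z)%type -> (v * z)%type -> (v * z)%type})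
  (G : topologicalGroupType) (exp : v * z -> G) (Ad : G -> 'End((v * z)%type)) :
  arises_from_semisimple_module brz j ip lb ->
  lie_group_with_lie_algebra lb exp Ad ->
  forall Y : v * z, lie_poisson j Y = 0 ->
    elliptic_on_orbit ip exp Ad (lie_poisson j) Y /\
    lyapunov_stable_on_orbit ip Ad (lie_poisson j) Y.
Proof.
move=> modH lieG Y eqY; split.
- exact: (lie_poisson_elliptic modH lieG).
- exact: (lie_poisson_stable modH lieG eqY).
Qed.
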